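(* Let $\sigma\in\mathbb{C}$ be such that $P(\sigma)$ (defined in the context) is invertible, let $X\in\mathbb{C}^{n_z\times n_x}$, let $C\in\mathbb{C}^{n_z\times n_x}$ be a given matrix, let $\bar k$ be a free (scalar) parameter, and let $$S(\sigma):=Q(\sigma)-C_1P(\sigma)^{-1}C_2^T.$$ Then $\mathrm{vec}(X)$ is a solution to $S(\sigma)\,\mathrm{vec}(X)=\mathrm{vec}(C)$ if and only if $X$ is a solution to $$AX+XB+(K-\bar k\,\mathbf{1}\mathbf{1}^T)\circ X-P_-(\sigma)^{-1}XE-P_+(\sigma)^{-1}XJ_{n_x}EJ_{n_x}=C,$$ where $A:=D_{zz}+2\sigma D_z+\sigma^2I_{n_z}+\bar kI_{n_z}$, $B:=D_{xx}$, $E:=\frac{1}{h_x^2}(d_1e_1+d_2e_2)e_1^T\in\mathbb{C}^{n_x\times n_x}$, and $J_{n_x}$ is the $n_x\times n_x$ flipped identity matrix.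
   Context: Notation: $\circ$ is the Hadamard (element-wise) product, $\otimes$ is the Kronecker product, $\mathrm{vec}$ stacks the columns of a matrix into one vector, $I_n$ is the $n\times n$ identity matrix, $J_n\in\mathbb{R}^{n\times n}$ is the flipped identity ($[J_n]_{k,\ell}=1$ if $k=n-\ell+1$ and $0$ otherwise), $\mathbf{1}$ is a column vector of ones (of the appropriate length, so that $\mathbf{1}\mathbf{1}^T$ is the $n_z\times n_x$ all-ones matrix), $e_j$ is the $j$-th standard basis vector (of the appropriate dimension), $\mathrm{diag}(v)$ is the diagonal matrix with the entries of $v$ on its diagonal. Grid: $n_x\ge 2$ is an integer, $n_z=2p+1$ with $p$ a nonnegative integer; $x_-<x_+$ are real; $h_x=(x_+-x_-)/(n_x+1)$, $h_z=1/n_z$; $x_k=x_-+kh_x$ for $k=1,\dots,n_x$ and $z_\ell=\ell h_z$ for $\ell=1,\dots,n_z$. The wavenumber $\kappa(x,z)$ is a given bounded piecewise constant function, $1$-periodic in $z$, equal to constants $\kappa_-$ and $\kappa_+$ for all sufficiently negative, respectively sufficiently positive, $x$. The matrix $K\in\mathbb{C}^{n_z\times n_x}$ is given by $[K]_{k,\ell}=\kappa^2(x_\ell,z_k)$. Difference matrices: let $Z_n\in\mathbb{R}^{n\times n}$ be the shift matrix, $[Z_n]_{k,l}=1$ if $k-l=1$ and $0$ otherwise. Then $D_{xx}=(-2I_{n_x}+Z_{n_x}+Z_{n_x}^T)/h_x^2$, $D_z=(Z_{n_z}+e_1e_{n_z}^T-Z_{n_z}^T-e_{n_z}e_1^T)/(2h_z)$,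 $D_{zz}=(-2I_{n_z}+Z_{n_z}+e_1e_{n_z}^T+Z_{n_z}^T+e_{n_z}e_1^T)/h_z^2$. Matrices defining $S$, for $\gamma\in\mathbb{C}$: $Q(\gamma)=A_0+\gamma A_1+\gamma^2A_2\in\mathbb{C}^{n_xn_z\times n_xn_z}$ with $A_0=D_{xx}^T\otimes I_{n_z}+I_{n_x}\otimes D_{zz}+\mathrm{diag}(\mathrm{vec}(K))$, $A_1=2I_{n_x}\otimes D_z$, $A_2=I_{n_xn_z}$; $C_1=\frac{1}{h_x^2}\left(e_1\otimes I_{n_z},\ e_{n_x}\otimes I_{n_z}\right)\in\mathbb{C}^{n_xn_z\times 2n_z}$; $C_2^T=\begin{pmatrix} d_1e_1^T\otimes I_{n_z}+d_2e_2^T\otimes I_{n_z}\\ d_1e_{n_x}^T\otimes I_{n_z}+d_2e_{n_x-1}^T\otimes I_{n_z}\end{pmatrix}\in\mathbb{C}^{2n_z\times n_xn_z}$ with $d_1=\frac{2}{h_x}$, $d_2=-\frac{1}{2h_x}$; $P(\gamma)=\begin{pmatrix}P_-(\gamma)&0\\0&P_+(\gamma)\end{pmatrix}\in\mathbb{C}^{2n_z\times 2n_z}$ with $P_\pm(\gamma)=R\Lambda_\pm(\gamma)R^{-1}$, where $[R]_{k,\ell}=e^{2\pi i(\ell-p-1)kh_z}$ for $k,\ell=1,\dots,n_z$, $\Lambda_\pm(\gamma)=\mathrm{diag}\left(s_{\pm,-p}(\gamma)+d_0,\ s_{\pm,-p+1}(\gamma)+d_0,\dots,s_{\pm,p}(\gamma)+d_0\right)$,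 $d_0=-\frac{3}{2h_x}$, and $s_{\pm,k}(\gamma)=\mathrm{sign}(\mathrm{Im}(\beta_{\pm,k}(\gamma)))\, i\sqrt{\beta_{\pm,k}(\gamma)}$, $\beta_{\pm,k}(\gamma)=(\gamma+2\pi ik)^2+\kappa_\pm^2$ (principal square root). *)

(* Defs.v *)
From HB Require Import structures.
From mathcomp Require Import all_boot all_order all_algebra.
From mathcomp Require Import all_classical all_reals all_analysis.
From mathcomp Require Export mxtens complex.

Set Implicit Arguments.
Unset Strict Implicit.
Unset Printing Implicit Defensive.

Import Order.TTheory GRing.Theory Num.Theory numFieldNormedType.Exports.
Local Open Scope classical_set_scope.
Local Open Scope complex_scope.
Local Open Scope ring_scope.

(* Matrix indices are 0-based here and 1-based in the paper: the paper's index
   k is i.+1 for i : 'I_n.  The Kronecker product is tensmx, [A *t B]. *)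

(* The plane is the closure of a locally finite union of disjoint open pieces,
   on each of which f is constant; the values on the interfaces are
   unrestricted, as is usual for coefficients of a PDE. *)
Definition piecewise_constant (R : realType) (V : Type) (f : R -> R -> V) :=
  exists U : nat -> set (R * R),
    [/\ forall n, open (U n),
        trivIset setT U,
        forall q : R * R, exists2 N, nbhs q N &
          finite_set [set n | U n `&` N !=set0],
        closure (\bigcup_n U n) = setT
      & forall n, exists c, forall q, U n q -> f q.1 q.2 = c].

Section Matrices.
Variable F : comNzRingType.

(* The row index of [*t] varies slowest in its first factor, so the column
   number of X is the first component of mxtens_unindex. *)
Definition vec m n (X : 'M[F]_(m, n)) : 'cV[F]_(n * m) :=
  \col_i X (mxtens_unindex i).2 (mxtens_unindex i).1.

Definition hadamard m n (X Y : 'M[F]_(m, n)) : 'M[F]_(m, n) :=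
  map2_mx *%R X Y.

(* e_j with j counted from 1, as in the paper. *)
Definition evec n (j : nat) : 'cV[F]_n := \col_(i < n) (i.+1 == j)%:R.

Definition ones n : 'cV[F]_n := const_mx 1.

Definition flip_mx n : 'M[F]_n :=
  \matrix_(k, l) (k.+1 == n - l.+1 + 1)%N%:R.

Definition shift_mx n : 'M[F]_n := \matrix_(k, l) (k == l.+1 :> nat)%:R.

(* v (x) I_m and v^T (x) I_m, with the dimension 1 * m read as m. *)
Definition col_tens1 n (v : 'cV[F]_n) m : 'M[F]_(n * m, m) :=
  castmx (erefl, mul1n m) (v *t (1%:M : 'M[F]_m)).

Definition row_tens1 n (v : 'rV[F]_n) m : 'M[F]_(m, n * m) :=
  castmx (mul1n m, erefl) (v *t (1%:M : 'M[F]_m)).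

End Matrices.

Section Waveguide.
Variable R : realType.
Implicit Types (h : R) (g c : R[i]).

Definition step_x (nx : nat) (xm xp : R) : R := (xp - xm) / (nx + 1)%:R.
Definition step_z (nz : nat) : R := 1 / nz%:R.

Definition wavenumber_mx (nx nz : nat) (xm xp : R) (kappa : R -> R -> R[i]) :
    'M[R[i]]_(nz, nx) :=
  \matrix_(k, l) kappa (xm + l.+1%:R * step_x nx xm xp)
                       (k.+1%:R * step_z nz) ^+ 2.

Definition Dxx n h : 'M[R[i]]_n :=
  (1 / h ^+ 2)%:C *: (- 2 *: 1%:M + shift_mx _ n + (shift_mx _ n)^T).

Definition Dz n h : 'M[R[i]]_n :=
  (1 / (2 * h))%:C *:
    (shift_mx _ n + evec _ n 1 *m (evec _ n n)^T
     - (shift_mx _ n)^T - evec _ n n *m (evec _ n 1)^T).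

Definition Dzz n h : 'M[R[i]]_n :=
  (1 / h ^+ 2)%:C *:
    (- 2 *: 1%:M + shift_mx _ n + evec _ n 1 *m (evec _ n n)^T
     + (shift_mx _ n)^T + evec _ n n *m (evec _ n 1)^T).

Definition d0 h : R[i] := (- (3 / (2 * h)))%:C.
Definition d1 h : R[i] := (2 / h)%:C.
Definition d2 h : R[i] := (- (1 / (2 * h)))%:C.

Definition Q nx nz hx hz (K : 'M[R[i]]_(nz, nx)) g : 'M[R[i]]_(nx * nz) :=
  let A0 := (Dxx nx hx)^T *t (1%:M : 'M[R[i]]_nz) + (1%:M : 'M[R[i]]_nx) *t Dzz nz hz
            + diag_mx (vec K)^T in
  let A1 := 2 *: ((1%:M : 'M[R[i]]_nx) *t Dz nz hz) in
  let A2 := 1%:M in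
  A0 + g *: A1 + g ^+ 2 *: A2.

Definition C1 nx nz hx : 'M[R[i]]_(nx * nz, nz + nz) :=
  (1 / hx ^+ 2)%:C *:
    row_mx (col_tens1 (evec _ nx 1) nz) (col_tens1 (evec _ nx nx) nz).

Definition C2T nx nz hx : 'M[R[i]]_(nz + nz, nx * nz) :=
  col_mx
    (row_tens1 (d1 hx *: (evec _ nx 1)^T) nz
     + row_tens1 (d2 hx *: (evec _ nx 2)^T) nz)
    (row_tens1 (d1 hx *: (evec _ nx nx)^T) nz
     + row_tens1 (d2 hx *: (evec _ nx (nx - 1))^T) nz).

Definition expi (t : R) : R[i] := cos t +i* sin t.

Definition beta c (k : int) g : R[i] :=
  (g + (2 * pi)%:C * 'i * k%:~R) ^+ 2 + c ^+ 2.

(* complex.sqrtc is the principal square root; Num.sqrtC is not, as it takes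
   its values in the upper half-plane. *)
Definition s c (k : int) g : R[i] :=
  (Num.sg (complex.Im (beta c k g)))%:C * 'i * sqrtc (beta c k g).

Definition fourier_mx p nz : 'M[R[i]]_nz :=
  \matrix_(k, l)
    expi (2 * pi * (l.+1%:Z - p%:Z - 1)%:~R * k.+1%:R * step_z nz).

(* P_- and P_+ are obtained for c = kappa_- and c = kappa_+. *)
Definition Pside p nz hx c g : 'M[R[i]]_nz :=
  fourier_mx p nz
  *m diag_mx (\row_(l < nz) (s c (l%:Z - p%:Z) g + d0 hx))
  *m invmx (fourier_mx p nz).

Definition P p nz hx cm cp g : 'M[R[i]]_(nz + nz) :=
  block_mx (Pside p nz hx cm g) 0 0 (Pside p nz hx cp g).

Definition S p nx nz hx hz (K : 'M[R[i]]_(nz, nx)) cm cp g :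
    'M[R[i]]_(nx * nz) :=
  Q hx hz K g - C1 nx nz hx *m invmx (P p nz hx cm cp g) *m C2T nx nz hx.

Definition E nx hx : 'M[R[i]]_nx :=
  (1 / hx ^+ 2)%:C *:
    ((d1 hx *: evec _ nx 1 + d2 hx *: evec _ nx 2) *m (evec _ nx 1)^T).

End Waveguide.

(* Main.v *)
Require Import Defs.
From mathcomp Require Import all_boot all_order all_algebra.
From mathcomp Require Import zify ring.
From mathcomp Require Import all_classical all_reals all_analysis.
Import Order.TTheory GRing.Theory Num.Theory numFieldNormedType.Exports.
Local Open Scope classical_set_scope.
Local Open Scope complex_scope.
Local Open Scope ring_scope.

(* Each term of the equation for vec X is turned into vec of the matching term
   of the matrix equation by the rule (B (x) A) vec X = vec (A X B^T); the
   claim then follows since vec is injective.  The terms in kbar cancel, and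
   conjugating E by the flip J_n sends e_j to e_(n-j+1), which turns the left
   boundary term into the right one. *)

Section Vectorization.
Variable F : comNzRingType.

Lemma vec_inj m n : injective (@vec F m n).
Proof.
move=> X Y /matrixP XY; apply/matrixP => i j.
(* Columns are stacked, so entry [(i, j)] sits at the position indexed by [(j, i)]. *)
by have := XY (mxtens_index (j, i)) 0; rewrite !mxE mxtens_indexK.
Qed.

Lemma vecD m n (X Y : 'M[F]_(m, n)) : vec (X + Y) = vec X + vec Y.
Proof. by apply/matrixP => i j; rewrite !mxE. Qed.

Lemma vecN m n (X : 'M[F]_(m, n)) : vec (- X) = - vec X.
Proof. by apply/matrixP => i j; rewrite !mxE. Qed.

Lemma vecZ m n (a : F) (X : 'M[F]_(m, n)) : vec (a *: X) = a *: vec X.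
Proof. by apply/matrixP => i j; rewrite !mxE. Qed.

Lemma vecBD m n (X Y Z : 'M[F]_(m, n)) : vec X - vec (Y + Z) = vec (X - Y - Z).
Proof. by rewrite -vecN -vecD opprD addrA. Qed.

Lemma sum_mxtens m n (f : 'I_m -> 'I_n -> F) :
  \sum_(k < m * n) f (mxtens_unindex k).1 (mxtens_unindex k).2
  = \sum_(i < m) \sum_(j < n) f i j.
Proof.
rewrite pair_big (reindex (@mxtens_index m n)); last first.
  by exists (@mxtens_unindex m n) => ? _;
    [apply: mxtens_indexK | apply: mxtens_unindexK].
by apply: eq_bigr => -[i j] _; rewrite mxtens_indexK.
Qed.

Lemma tensmx_vec m n q r (A : 'M[F]_(q, m)) (B : 'M[F]_(r, n))
    (X : 'M[F]_(m, n)) :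
  (B *t A) *m vec X = vec (A *m X *m B^T).
Proof.
apply/matrixP => i j; rewrite !mxE.
set i1 := (mxtens_unindex i).1; set i2 := (mxtens_unindex i).2.
under eq_bigr do rewrite !mxE.
rewrite (sum_mxtens _ _ (fun k l => B i1 k * A i2 l * X l k)).
apply: eq_bigr => k _; rewrite !mxE mulr_suml; apply: eq_bigr => l _.
by rewrite -mulrA mulrC.
Qed.

Lemma diag_vec m n (K X : 'M[F]_(m, n)) :
  diag_mx (vec K)^T *m vec X = vec (hadamard K X).
Proof. by apply/matrixP => i j; rewrite mul_diag_mx !mxE. Qed.

(** Stacking a single column changes nothing but the type. This makes the products with [col_tens1]
    and [row_tens1] below instances of [tensmx_vec]. *)
Lemma castmx_vec m (y : 'cV[F]_m) : castmx (mul1n m, erefl) (vec y) = y.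
Proof.
apply/matrixP => i j; rewrite castmxE !mxE !ord1; congr (y _ _).
by apply: val_inj; rewrite /= modn_small.
Qed.

Lemma col_tens1_mul n (v : 'cV[F]_n) m (y : 'cV[F]_m) :
  col_tens1 v m *m y = vec (y *m v^T).
Proof.
rewrite -[in LHS](castmx_vec _ y) -[y in RHS]mul1mx -tensmx_vec /col_tens1.
by rewrite mulmx_cast castmx_comp !castmx_id.
Qed.

Lemma row_tens1_vec n (v : 'cV[F]_n) m (X : 'M[F]_(m, n)) :
  row_tens1 v^T m *m vec X = X *m v.
Proof.
rewrite -[RHS]castmx_vec -[v in RHS]trmxK -[X in RHS]mul1mx -tensmx_vec.
by rewrite /row_tens1 (castmx_mul _ erefl) castmx_id.
Qed.

Lemma hadamardBl m n (K L X : 'M[F]_(m, n)) :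
  hadamard (K - L) X = hadamard K X - hadamard L X.
Proof. by apply/matrixP => i j; rewrite !mxE mulrBl. Qed.

Lemma hadamard_ones m n a (X : 'M[F]_(m, n)) :
  hadamard (a *: (ones F m *m (ones F n)^T)) X = a *: X.
Proof. by apply/matrixP => i j; rewrite !mxE big_ord1 !mxE !mulr1. Qed.

(** This handles the part [Q]. The second transpose, from [tensmx_vec], undoes that of [T], so no
    symmetry of [T] enters. *)
Lemma quadratic_vec m n (T : 'M[F]_n) (L D : 'M[F]_m) (K X : 'M[F]_(m, n))
    g k :
  (T^T *t 1%:M + 1%:M *t L + diag_mx (vec K)^T
   + g *: (2 *: (1%:M *t D)) + g ^+ 2 *: 1%:M) *m vec X
  = vec ((L + (2 * g) *: D + g ^+ 2 *: 1%:M + k *: 1%:M) *m X + X *m T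
         + hadamard (K - k *: (ones F m *m (ones F n)^T)) X).
Proof.
rewrite !mulmxDl -!scalemxAl !tensmx_vec diag_vec trmxK trmx1.
rewrite !mulmx1 !mul1mx -!vecZ -!vecD hadamardBl hadamard_ones; congr vec.
move: (L *m X) (D *m X) (X *m T) (hadamard K X) => LX DX XT KX.
apply/matrixP => i j; rewrite !mxE; ring.
Qed.

(** The block diagonal decouples the two sides. On each side the row block reads off a combination
    of columns of [X], [M] or [N] acts on it, and the column block spreads the result along [u] or
    [v]. *)
Lemma boundary_vec m n (u v a b c d : 'cV[F]_n) (x y : F)
    (M N : 'M[F]_m) (X : 'M[F]_(m, n)) :
  row_mx (col_tens1 u m) (col_tens1 v m) *m block_mx M 0 0 N
    *m col_mx (row_tens1 (x *: a^T) m + row_tens1 (y *: b^T) m)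
              (row_tens1 (x *: c^T) m + row_tens1 (y *: d^T) m)
    *m vec X
  = vec (M *m X *m ((x *: a + y *: b) *m u^T)
         + N *m X *m ((x *: c + y *: d) *m v^T)).
Proof.
have trZ z (w : 'cV[F]_n) : z *: w^T = (z *: w)^T by rewrite linearZ.
rewrite !trZ mul_row_block !mulmx0 addr0 add0r mul_row_col mulmxDl -!mulmxA.
rewrite !(mulmxDl _ _ (vec X)) !row_tens1_vec !col_tens1_mul -!mulmxDr -vecD.
by rewrite !mulmxA.
Qed.

Lemma tr_flip_mx n : (flip_mx F n)^T = flip_mx F n.
Proof.
apply/matrixP => i j; rewrite !mxE; congr (_%:R).
(* The bounds make the truncated subtraction exact, so both conditions read [i + j + 1 = n]. *)
have lt_in := ltn_ord i; have lt_jn := ltn_ord j; lia.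
Qed.

Lemma flip_evec n j : (0 < j <= n)%N ->
  flip_mx F n *m evec F n j = evec F n (n - j + 1).
Proof.
case: j => // j lt_jn; apply/matrixP => i k; rewrite !mxE.
rewrite (bigD1 (Ordinal lt_jn)) //= big1 => [|l ne_lj].
  by rewrite !mxE eqxx mulr1 addr0.
have /negbTE ne_lj_nat : (l : nat) != j by [].
by rewrite !mxE eqSS ne_lj_nat mulr0.
Qed.

Lemma flip_conj_evec n a b : (2 <= n)%N ->
  flip_mx F n *m ((a *: evec F n 1 + b *: evec F n 2) *m (evec F n 1)^T)
    *m flip_mx F n
  = (a *: evec F n n + b *: evec F n (n - 1)) *m (evec F n n)^T.
Proof.
(* Symmetry of the flip turns the right factor into the transpose of a flipped basis vector, so
   [flip_evec] serves both factors. *)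
move=> n_ge2; rewrite mulmxA -mulmxA -{2}tr_flip_mx -trmx_mul mulmxDr.
rewrite -!scalemxAr !flip_evec ?(ltnW n_ge2) //.
have -> : (n - 1 + 1 = n)%N by lia.
by have -> : (n - 2 + 1 = n - 1)%N by lia.
Qed.

(** The factor [t], which stands for [1 / hx ^+ 2], moves from the column blocks into [E]. *)
Lemma boundary_flip_vec m n t x y (M N : 'M[F]_m) (X : 'M[F]_(m, n)) :
  (2 <= n)%N ->
  let E := t *: ((x *: evec F n 1 + y *: evec F n 2) *m (evec F n 1)^T) in
  (t *: row_mx (col_tens1 (evec F n 1) m) (col_tens1 (evec F n n) m))
    *m block_mx M 0 0 N
    *m col_mx (row_tens1 (x *: (evec F n 1)^T) m
               + row_tens1 (y *: (evec F n 2)^T) m)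
              (row_tens1 (x *: (evec F n n)^T) m
               + row_tens1 (y *: (evec F n (n - 1))^T) m)
    *m vec X
  = vec (M *m X *m E + N *m X *m flip_mx F n *m E *m flip_mx F n).
Proof.
move=> n_ge2 /=; rewrite -!scalemxAl boundary_vec -flip_conj_evec // -vecZ.
by rewrite -!scalemxAr -scalemxAl scalerDr !mulmxA.
Qed.

End Vectorization.

Theorem proposition3p1 (R : realType) (nx nz p : nat)
  (hnx : (2 <= nx)%N) (hnz : nz = (2 * p + 1)%N)
  (xm xp : R) (hx_lt : xm < xp)
  (kappa : R -> R -> R[i]) (kappam kappap : R[i])
  (kappa_bounded : exists M : R, forall x z, `|kappa x z| <= M%:C)
  (kappa_pwc : piecewise_constant kappa)
  (kappa_periodic : forall x z, kappa x (z + 1) = kappa x z)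
  (kappa_left : \forall x \near -oo, forall z, kappa x z = kappam)
  (kappa_right : \forall x \near +oo, forall z, kappa x z = kappap)
  (sigma kbar : R[i]) (X C : 'M[R[i]]_(nz, nx)) :
  let hx := step_x nx xm xp in
  let hz := step_z R nz in
  let K := wavenumber_mx nx nz xm xp kappa in
  let Pm := Pside p nz hx kappam sigma in
  let Pp := Pside p nz hx kappap sigma in
  let J := flip_mx R[i] nx in
  let A := Dzz nz hz + (2 * sigma) *: Dz nz hz + sigma ^+ 2 *: 1%:M
           + kbar *: 1%:M in
  let B := Dxx nx hx in
  P p nz hx kappam kappap sigma \in unitmx ->
  S p hx hz K kappam kappap sigma *m vec X = vec C
  <->
  A *m X + X *m B + hadamard (K - kbar *: (ones _ nz *m (ones _ nx)^T)) X
  - invmx Pm *m X *m E nx hx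
  - invmx Pp *m X *m J *m E nx hx *m J = C.
Proof.
move=> hx hz K Pm Pp J A B Punit.
have QX : Q hx hz K sigma *m vec X =
    vec (A *m X + X *m B
         + hadamard (K - kbar *: (ones _ nz *m (ones _ nx)^T)) X).
  exact: quadratic_vec.
have CX : C1 nx nz hx *m invmx (P p nz hx kappam kappap sigma)
    *m C2T nx nz hx *m vec X =
    vec (invmx Pm *m X *m E nx hx + invmx Pp *m X *m J *m E nx hx *m J).
  (* Invertibility of [P] enters here: [invmx] returns a singular matrix unchanged, so only for
     invertible [P] is its value sure to be the blockwise inverse. *)
  by rewrite /C1 /C2T invmx_block_diag //; exact: boundary_flip_vec.
rewrite /S mulmxBl QX CX vecBD.
by split=> [/vec_inj|->].
Qed.
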